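(* Let $V$ be a vertex operator algebra, $(W_1,Y_1)$, $(W_2,Y_2)$ $V$-modules and $z\in\mathbb C^\times$. Let $\lambda\in(W_1\otimes W_2)^*$ satisfy the compatibility condition. Then for all $v_1,v_2\in V$, $$x_0^{-1}\delta\Big(\frac{x_1-x_2}{x_0}\Big)Y'_{Q(z)}(v_1,x_1)Y'_{Q(z)}(v_2,x_2)\lambda-x_0^{-1}\delta\Big(\frac{x_2-x_1}{-x_0}\Big)Y'_{Q(z)}(v_2,x_2)Y'_{Q(z)}(v_1,x_1)\lambda=x_2^{-1}\delta\Big(\frac{x_1-x_0}{x_2}\Big)Y'_{Q(z)}(Y(v_1,x_0)v_2,x_2)\lambda.$$
   Context: $V$ is a vertex operator algebra with vertex operator $Y$ and Virasoro operators $L(n)$; $V$-modules are graded by $L(0)$-eigenvalues. $\delta(x)=\sum_{n\in\mathbb Z}x^n$; binomial expressions are expanded in nonnegative integral powers of the second variable; $\mathrm{Res}_y$ is the coefficient of $y^{-1}$. $Y_1^*(v,x)=Y_1(e^{xL(1)}(-x^{-2})^{L(0)}v,x^{-1})$ on $W_1$. $(W_1\otimes W_2)^*$ is the full dual of $W_1\otimes W_2$. For $v\in V$, $\lambda\in(W_1\otimes W_2)^*$: $(Y'_{Q(z)}(v,x)\lambda)(w_{(1)}\otimes w_{(2)})=\mathrm{Res}_y\,x^{-1}\delta(\frac{y-z}{x})\lambda(Y_1^*(v,y)w_{(1)}\otimes w_{(2)})-\mathrm{Res}_y\,x^{-1}\delta(\frac{z-y}{-x})\lambda(w_{(1)}\otimes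 Y_2(v,y)w_{(2)})$. An element $\lambda$ satisfies the compatibility condition if (a) (lower truncation) for every $v\in V$, $Y'_{Q(z)}(v,x)\lambda$ contains only finitely many negative powers of $x$; and (b) for all $v\in V$, $w_{(1)}\in W_1$, $w_{(2)}\in W_2$, $$x_0^{-1}\delta\Big(\frac{x_1-z}{x_0}\Big)\lambda(Y_1^*(v,x_1)w_{(1)}\otimes w_{(2)})-x_0^{-1}\delta\Big(\frac{z-x_1}{-x_0}\Big)\lambda(w_{(1)}\otimes Y_2(v,x_1)w_{(2)})=x_1^{-1}\delta\Big(\frac{z+x_0}{x_1}\Big)(Y'_{Q(z)}(v,x_0)\lambda)(w_{(1)}\otimes w_{(2)}).$$ *)

(* Defs.v *)
From HB Require Import structures.
From mathcomp Require Import all_boot all_order all_algebra.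
From mathcomp Require Import complex.
From mathcomp Require Import classical_sets fsbigop reals.
Set Implicit Arguments. Unset Strict Implicit. Unset Printing Implicit Defensive.
Import Order.TTheory GRing.Theory Num.Theory.
Local Open Scope ring_scope.

(*  - A vertex operator Y(u,x) = sum_n u_n x^{-n-1} is represented by its      *)
(*    modes: [Y u w n] = u_n w  (n : int).                                    *)
(*  - A formal series in x1, x2, ... with coefficients in M is represented by  *)
(*    its coefficient function: [A e1 e2] = coefficient of x1^e1 x2^e2.       *)
(*  - Binomial expansions (a + b)^n, n : int, are expanded in nonnegative      *)
(*    powers of the second variable: sum_{k>=0} binom(n,k) a^{n-k} b^k, with  *)
(*    binom(n,k) = n(n-1)...(n-k+1)/k!.                                       *)
(*  - Infinite sums arising in products of formal series are sums of          *)
(*    finitely supported families (fsbigop: if the support is infinite the     *)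
(*    "sum" is 0, but in every use below the support is finite, which is      *)
(*    exactly the condition under which the product exists in formal          *)
(*    calculus).                                                               *)

Section FormalCalculus.
Variable K : fieldType.

Definition nsum (M : nmodType) (f : nat -> M) : M := \sum_(k \in @setT nat) f k.
Definition isum (M : nmodType) (f : int -> M) : M := \sum_(k \in @setT int) f k.

Definition gbinom (n : int) (k : nat) : K :=
  (\prod_(i < k) (n%:~R - i%:R)) / (k`!)%:R.

Variable M : lmodType K.

(* Coefficient of x0^e0 x1^e1 x2^e2 in  x0^{-1} delta((x1-x2)/x0) A(x1,x2)
   where x0^{-1}delta((x1-x2)/x0) = sum_n x0^{-n-1} (x1-x2)^n
                                 = sum_n sum_k binom(n,k) (-1)^k x0^{-n-1} x1^{n-k} x2^k. *)
Definition jac_T1 (A : int -> int -> M) (e0 e1 e2 : int) : M :=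
  let n := - e0 - 1 in
  nsum (fun k : nat => (gbinom n k * (-1) ^+ k) *: A (e1 - n + k%:Z) (e2 - k%:Z)).

(* Coefficient of x0^e0 x1^e1 x2^e2 in  x0^{-1} delta((x2-x1)/(-x0)) B(x1,x2)
   where x0^{-1}delta((x2-x1)/(-x0)) = sum_n (-1)^n x0^{-n-1} (x2-x1)^n
                               = sum_n sum_k (-1)^n binom(n,k) (-1)^k x0^{-n-1} x2^{n-k} x1^k. *)
Definition jac_T2 (B : int -> int -> M) (e0 e1 e2 : int) : M :=
  let n := - e0 - 1 in
  ((-1) ^ n) *:
  nsum (fun k : nat => (gbinom n k * (-1) ^+ k) *: B (e1 - k%:Z) (e2 - n + k%:Z)).

(* Coefficient of x0^e0 x1^e1 x2^e2 in  x2^{-1} delta((x1-x0)/x2) C(x0,x2)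
   where x2^{-1}delta((x1-x0)/x2) = sum_m x2^{-m-1} (x1-x0)^m
                                 = sum_m sum_k binom(m,k) (-1)^k x2^{-m-1} x1^{m-k} x0^k
   (the exponent of x1 forces m = e1 + k). *)
Definition jac_T3 (C : int -> int -> M) (e0 e1 e2 : int) : M :=
  nsum (fun k : nat => (gbinom (e1 + k%:Z) k * (-1) ^+ k) *:
                         C (e0 - k%:Z) (e2 + e1 + k%:Z + 1)).

Definition jacobi_identity (A B C : int -> int -> M) : Prop :=
  forall e0 e1 e2 : int, jac_T1 A e0 e1 e2 - jac_T2 B e0 e1 e2 = jac_T3 C e0 e1 e2.

End FormalCalculus.
Arguments gbinom {K} n k.

Section VOA.
Variable K : fieldType.

Definition in_span (M : lmodType K) (s : seq M) (w : M) : Prop :=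
  exists a : nat -> K, w = \sum_(i < size s) a i *: s`_i.

Definition Lop (V W : lmodType K) (YW : V -> W -> int -> W) (om : V) (n : int) (w : W) : W :=
  YW om w (n + 1).

Record module_axioms (V : lmodType K) (Y : V -> V -> int -> V) (vac om : V) (c : K)
    (W : lmodType K) (YW : V -> W -> int -> W) : Prop := {
  ma_linl : forall (a : K) (u u' : V) (w : W) (n : int),
          YW (a *: u + u') w n = a *: YW u w n + YW u' w n;
  ma_linr : forall (a : K) (u : V) (w w' : W) (n : int),
          YW u (a *: w + w') n = a *: YW u w n + YW u w' n;
  ma_trunc : forall (u : V) (w : W), exists N : int, forall n : int, N <= n -> YW u w n = 0;
  ma_vac : forall (w : W) (n : int), YW vac w n = if n == -1 then w else 0;
  ma_jacobi : forall (u v : V) (w : W),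
          jacobi_identity
            (fun e1 e2 => YW u (YW v w (- e2 - 1)) (- e1 - 1))
            (fun e1 e2 => YW v (YW u w (- e1 - 1)) (- e2 - 1))
            (fun e0 e2 => YW (Y u v (- e0 - 1)) w (- e2 - 1));
  ma_vir : forall (m n : int) (w : W),
          Lop YW om m (Lop YW om n w) - Lop YW om n (Lop YW om m w)
          = (m - n)%:~R *: Lop YW om (m + n) w
            + (if m + n == 0 then (((m ^+ 3 - m)%:~R / 12%:R) * c) *: w else 0);
  ma_deriv : forall (u : V) (w : W) (n : int),
          YW (Lop Y om (-1) u) w n = (- n)%:~R *: YW u w (n - 1) }.

(* Vertex operator algebra (V, Y, 1, omega) with central charge c.
   V = (+)_{n in Z} V_(n), V_(n) = {v | L(0) v = n v}; [proj n] is the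
   projection of V onto V_(n) along this decomposition. *)
Record is_voa (V : lmodType K) (Y : V -> V -> int -> V) (vac om : V) (c : K)
    (proj : int -> V -> V) : Prop := {
  voa_mod : module_axioms Y vac om c Y;
  voa_proj_lin : forall (n : int) (a : K) (u u' : V),
      proj n (a *: u + u') = a *: proj n u + proj n u';
  voa_proj_wt : forall (n : int) (v : V), Lop Y om 0 (proj n v) = n%:~R *: proj n v;
  voa_proj_sum : forall v : V, exists s : seq int,
          v = \sum_(n <- s) proj n v /\ forall n, n \notin s -> proj n v = 0;
  voa_fdim : forall n : int, exists s : seq V,
          forall v, Lop Y om 0 v = n%:~R *: v -> in_span s v;
  voa_lowb : exists N : int, forall (n : int) (v : V),
      n < N -> Lop Y om 0 v = n%:~R *: v -> v = 0;
  voa_creat1 : forall (v : V) (n : int), 0 <= n -> Y v vac n = 0;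
  voa_creat2 : forall v : V, Y v vac (-1) = v;
  voa_vac_wt : Lop Y om 0 vac = 0;
  voa_om_wt : Lop Y om 0 om = 2%:R *: om }.

Record is_module (V : lmodType K) (Y : V -> V -> int -> V) (vac om : V) (c : K)
    (W : lmodType K) (YW : V -> W -> int -> W) : Prop := {
  mod_ax : module_axioms Y vac om c YW;
  mod_grad : forall w : W, exists s : seq (K * W),
          (forall p, p \in s -> Lop YW om 0 p.2 = p.1 *: p.2) /\ w = \sum_(p <- s) p.2;
  mod_fdim : forall a : K, exists s : seq W,
      forall w, Lop YW om 0 w = a *: w -> in_span s w;
  mod_lowb : forall a : K, exists N : int, forall (k : int) (w : W),
          k < N -> Lop YW om 0 w = (a + k%:~R) *: w -> w = 0 }.

(* Coefficient of x^e in  Y_1^*(v,x) w = Y_1(e^{x L(1)} (-x^{-2})^{L(0)} v, x^{-1}) w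
   = sum_h sum_j (-1)^h / j! * Y_1(L(1)^j proj_h v, x^{-1}) w x^{j - 2h},
   with Y_1(u, x^{-1}) w = sum_m u_m w x^{m+1}. *)
Definition Ystar (V W : lmodType K) (Y : V -> V -> int -> V) (om : V)
    (proj : int -> V -> V) (YW : V -> W -> int -> W) (v : V) (w : W) (e : int) : W :=
  isum (fun h : int => nsum (fun j : nat =>
     ((-1) ^ h / (j`!)%:R) *:
       YW (iter j (Lop Y om 1) (proj h v)) w (e - 1 - j%:Z + 2 * h))).

End VOA.

Section QZ.
Variable K : fieldType.
Variable z : K.

(* Coefficient of x0^e0 x1^e1 in x0^{-1}delta((x1-z)/x0) F(x1)
   = sum_n sum_k binom(n,k) (-z)^k x0^{-n-1} x1^{n-k} F(x1). *)
Definition dz1 (F : int -> K) (e0 e1 : int) : K :=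
  let n := - e0 - 1 in
  nsum (fun k : nat => gbinom n k * (- z) ^+ k * F (e1 - n + k%:Z)).

(* Coefficient of x0^e0 x1^e1 in x0^{-1}delta((z-x1)/(-x0)) G(x1)
   = sum_n sum_k (-1)^n binom(n,k) z^{n-k} (-1)^k x0^{-n-1} x1^k G(x1). *)
Definition dz2 (G : int -> K) (e0 e1 : int) : K :=
  let n := - e0 - 1 in
  (-1) ^ n * nsum (fun k : nat => gbinom n k * z ^ (n - k%:Z) * (-1) ^+ k * G (e1 - k%:Z)).

(* Coefficient of x0^e0 x1^e1 in x1^{-1}delta((z+x0)/x1) H(x0)
   = sum_m sum_k binom(m,k) z^{m-k} x1^{-m-1} x0^k H(x0). *)
Definition dz3 (H : int -> K) (e0 e1 : int) : K :=
  let m := - e1 - 1 in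
  nsum (fun k : nat => gbinom m k * z ^ (m - k%:Z) * H (e0 - k%:Z)).

Variables (V W1 W2 : lmodType K) (Y : V -> V -> int -> V) (om : V) (proj : int -> V -> V)
          (Y1 : V -> W1 -> int -> W1) (Y2 : V -> W2 -> int -> W2).

(* Elements of the full dual (W1 (x) W2)^* are identified with bilinear forms
   W1 x W2 -> K. *)
Record bilinear_form (lam : W1 -> W2 -> K) : Prop := {
  bil_l : forall (a : K) (u u' : W1) (w : W2), lam (a *: u + u') w = a * lam u w + lam u' w;
  bil_r : forall (a : K) (u : W1) (w w' : W2), lam u (a *: w + w') = a * lam u w + lam u w' }.

Definition lamYstar (lam : W1 -> W2 -> K) (v : V) (w1 : W1) (w2 : W2) (e : int) : K :=
  lam (Ystar Y om proj Y1 v w1 e) w2.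

Definition lamY2 (lam : W1 -> W2 -> K) (v : V) (w1 : W1) (w2 : W2) (e : int) : K :=
  lam w1 (Y2 v w2 (- e - 1)).

(* [YQ v lam e] = coefficient of x^e in Y'_{Q(z)}(v,x) lam, an element of
   (W1 (x) W2)^*:
   (Y'_{Q(z)}(v,x)lam)(w1 (x) w2) = Res_y x^{-1}delta((y-z)/x) lam(Y_1^*(v,y)w1 (x) w2)
                                 - Res_y x^{-1}delta((z-y)/(-x)) lam(w1 (x) Y_2(v,y)w2),
   where Res_y = coefficient of y^{-1}. *)
Definition YQ (v : V) (lam : W1 -> W2 -> K) (e : int) : W1 -> W2 -> K :=
  fun w1 w2 => dz1 (lamYstar lam v w1 w2) e (-1) - dz2 (lamY2 lam v w1 w2) e (-1).

Record compatibility (lam : W1 -> W2 -> K) : Prop := {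
  compat_trunc : forall v : V, exists N : int, forall (e : int) (w1 : W1) (w2 : W2),
      e < N -> YQ v lam e w1 w2 = 0;
  compat_jac : forall (v : V) (w1 : W1) (w2 : W2) (e0 e1 : int),
      dz1 (lamYstar lam v w1 w2) e0 e1 - dz2 (lamY2 lam v w1 w2) e0 e1
      = dz3 (fun e => YQ v lam e w1 w2) e0 e1 }.

End QZ.

(* Main.v *)
(* Write u_n lam for the coefficient of x^(-n-1) in Y'_Q(z)(u, x) lam.  It is
   Res_y (y - z)^n applied to the series A(u, y) = lam(Y_1^*(u, y) . , . ), expanded
   at y = oo, minus the same for B(u, y) = lam( . , Y_2(u, y) . ), expanded at 0.
   Compatibility gives an N with (y - z)^N A(u, y) = (y - z)^N B(u, y): the two
   series are expansions of one rational function with poles only at 0, z, oo.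

   Iterating, a product u_m v_n lam is a double residue of four series
   AA, AB, BA, BB.  In the left side of the Jacobi identity the mixed terms AB
   and BA occur in both products and cancel, leaving the double residue of
   (x - y)^l AA - (-y + x)^l AA' minus the one of (x - y)^l BB' - (-y + x)^l BB,
   where ' exchanges the order of the two operators.  The second is given by the
   Jacobi identity of W_2.  The first is the analogous statement for Y_1^* under
   lam; rather than deducing it from the conjugation formulas for L(0) and L(1),
   one transports it from W_2: multiplied by high powers of x - z and y - z, the
   A-series agree with the B-series, and such factors can be cancelled in series
   bounded on one side.

   Identities between expansions in different regions are proved by uniqueness:
   both sides obey Pascal's rule in an exponent l, agree for l = 0, and are
   truncated, which determines them for l < 0 as well. *)
Require Import Defs.
From HB Require Import structures.
From mathcomp Require Import all_boot all_order all_algebra.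
From mathcomp Require Import complex zify ring.
From mathcomp Require Import boolp classical_sets fsbigop reals.
Import Order.TTheory GRing.Theory Num.Theory.
Local Open Scope ring_scope.
Set Implicit Arguments.
Unset Strict Implicit.

(** * Sums of finitely supported families *)

Section FiniteSums.

Lemma nsum_ord (M : nmodType) (K : nat) (f : nat -> M) :
  (forall k, (K <= k)%N -> f k = 0) -> nsum f = \sum_(k < K) f k.
Proof.
move=> f0; rewrite fsbig_ord; apply/esym/fsbig_widen => //.
by move=> k [_ /= /negP]; rewrite -leqNgt => /f0.
Qed.

Lemma nsum0 (M : nmodType) (f : nat -> M) : (forall k, f k = 0) -> nsum f = 0.
Proof. by move=> f0; rewrite (@nsum_ord _ 0) ?big_ord0. Qed.

Lemma eq_nsum (M : nmodType) (f g : nat -> M) : f =1 g -> nsum f = nsum g.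
Proof. by move=> fg; congr nsum; apply: funext. Qed.

End FiniteSums.

(** * Binomial coefficients with integer upper entry *)

Section GeneralizedBinomials.
Variable K : numFieldType.

Lemma gbinom_nat0 (n : int) : gbinom n 0 = 1 :> K.
Proof. by rewrite /gbinom big_ord0 fact0 divr1. Qed.

Lemma gbinom0S (k : nat) : gbinom 0 k.+1 = 0 :> K.
Proof. by rewrite /gbinom big_ord_recl /= subrr !mul0r. Qed.

Lemma gbinom_Pascal (n : int) (k : nat) :
  gbinom (n + 1) k.+1 = gbinom n k.+1 + gbinom n k :> K.
Proof.
rewrite /gbinom big_ord_recl [X in _ = X / _ + _]big_ord_recr /=.
set Q := \prod_(i < k) (n%:~R - i%:R).
rewrite (eq_bigr (fun i : 'I_k => n%:~R - i%:R : K)); last first.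
  by move=> i _; rewrite /= /bump add1n -natr1 intrD; ring.
rewrite -/Q factS natrM intrD -natr1.
have k1 : k%:R + 1 != 0 :> K by rewrite natr1 pnatr_eq0.
have kf : (k`!)%:R != 0 :> K by rewrite pnatr_eq0 -lt0n fact_gt0.
by field; rewrite kf k1.
Qed.

(** Negate the k factors and reverse their order. This turns the coefficients in [jac_T3] into those
    of [bexp 1]. *)
Lemma gbinom_opp (n : int) (k : nat) :
  gbinom (n + k%:Z) k * (-1) ^+ k = gbinom (- n - 1) k :> K.
Proof.
rewrite /gbinom mulrAC; congr (_ / _).
have -> : (-1) ^+ k = \prod_(i < k) (-1) :> K by rewrite prodr_const card_ord.
rewrite -big_split [RHS](reindex_inj rev_ord_inj) /=.
apply: eq_bigr => i _; rewrite natrB ?ltn_ord // intrB intrD -natr1.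
by rewrite mulrNz !pmulrn; ring.
Qed.

End GeneralizedBinomials.

(* Series in x and y are given by their modes g p q = Res_x Res_y x^p y^q g(x, y),
   so that multiplication by x or y raises an index.  [bexp c l g] gives the modes
   of (x + c y)^l g(x, y), expanded in nonnegative powers of y. *)
Section BinomialExpansion.
Variable K : numFieldType.
Implicit Types (c : K) (l p q i j : int) (g h : int -> int -> K).

Definition bexp c l g p q : K :=
  nsum (fun k : nat => gbinom l k * c ^+ k * g (p + l - k%:Z) (q + k%:Z)).

(** Finite support along the antidiagonals over which [bexp] sums; otherwise [nsum] could take its
    default value 0. *)
Definition dsupp g :=
  forall p q, exists n : nat, forall k : nat, (n <= k)%N -> g (p - k%:Z) (q + k%:Z) = 0.

Lemma bexp_ord c l g p q (n : nat) :
    (forall k : nat, (n <= k)%N -> g (p + l - k%:Z) (q + k%:Z) = 0) ->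
  bexp c l g p q =
  \sum_(k < n) gbinom l k * c ^+ k * g (p + l - k%:Z) (q + k%:Z).
Proof.
by move=> g0; apply: (@nsum_ord _ n) => k nk; rewrite g0 ?mulr0.
Qed.

Lemma eq_bexp c l g h p q :
  (forall k : nat, g (p + l - k%:Z) (q + k%:Z) = h (p + l - k%:Z) (q + k%:Z)) ->
  bexp c l g p q = bexp c l h p q.
Proof. by move=> gh; apply: eq_nsum => k; rewrite gh. Qed.

Lemma bexp_eq0 c l g p q :
  (forall k : nat, g (p + l - k%:Z) (q + k%:Z) = 0) -> bexp c l g p q = 0.
Proof. by move=> g0; apply: nsum0 => k; rewrite g0 mulr0. Qed.

Lemma bexp0 c g p q : bexp c 0 g p q = g p q.
Proof.
rewrite /bexp (@nsum_ord _ 1); last by case=> // k _; rewrite gbinom0S !mul0r.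
by rewrite big_ord1 gbinom_nat0 expr0 !mul1r addr0 subr0 addr0.
Qed.

Lemma bexp_shift c l g p q (s t : int) :
  bexp c l (fun p q => g (p + s) (q + t)) p q = bexp c l g (p + s) (q + t).
Proof.
by apply: eq_nsum => k; congr (_ * g _ _); ring.
Qed.

Lemma dsupp_shift g s t : dsupp g -> dsupp (fun p q => g (p + s) (q + t)).
Proof.
move=> gs p q; have [n g0] := gs (p + s) (q + t); exists n => k nk.
by rewrite -(g0 k nk); congr (g _ _); lia.
Qed.

(** Multiplication by x + c y: the term of index k + 1 splits by Pascal's rule for [gbinom], also
    when the exponent is negative. *)
Lemma bexp_Pascal c l g p q : dsupp g ->
  bexp c (l + 1) g p q = bexp c l g (p + 1) q + c * bexp c l g p (q + 1).
Proof.
move=> /(_ (p + l + 1) q)[n g0].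
have g0' (k : nat) : (n <= k)%N -> g (p + l - k%:Z) (q + 1 + k%:Z) = 0.
  move=> nk; have := g0 k.+1 (leqW nk).
  by congr (g _ _ = 0); lia.
rewrite (@bexp_ord _ _ _ _ _ n.+1); last first.
  by move=> k /ltnW nk; rewrite -(g0 k nk); congr (g _ _); lia.
rewrite (@bexp_ord _ _ _ (p + 1) _ n.+1); last first.
  by move=> k /ltnW nk; rewrite -(g0 k nk); congr (g _ _); lia.
rewrite (bexp_ord c g0') mulr_sumr !big_ord_recl -[RHS]addrA.
congr (_ + _).
  by rewrite !gbinom_nat0; congr (_ * g _ _); lia.
rewrite -big_split /=; apply: eq_bigr => k _.
rewrite /bump !add1n gbinom_Pascal !mulrDl exprS; congr (_ + _).
  by congr (_ * g _ _); lia.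
by rewrite [X in X * _ = _]mulrCA -[LHS]mulrA; congr (_ * (_ * g _ _)); lia.
Qed.

Lemma bexpB c l g h p q : dsupp g -> dsupp h ->
  bexp c l (fun p q => g p q - h p q) p q = bexp c l g p q - bexp c l h p q.
Proof.
move=> /(_ (p + l) q)[n g0] /(_ (p + l) q)[m h0].
rewrite !(@bexp_ord _ _ _ _ _ (maxn n m)).
- by rewrite -sumrB; apply: eq_bigr => k _; rewrite mulrBr.
- by move=> k; rewrite geq_max => /andP[_ ?]; apply: h0.
- by move=> k; rewrite geq_max => /andP[? _]; apply: g0.
- by move=> k; rewrite geq_max => /andP[? ?]; rewrite g0 ?h0 ?subr0.
Qed.

Lemma bexpZ c l g p q (a : K) : dsupp g ->
  bexp c l (fun p q => a * g p q) p q = a * bexp c l g p q.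
Proof.
move=> /(_ (p + l) q)[n g0].
rewrite !(@bexp_ord _ _ _ _ _ n) //.
- by rewrite mulr_sumr; apply: eq_bigr => k _ /=; rewrite mulrCA.
- by move=> k nk; rewrite g0 ?mulr0.
Qed.

End BinomialExpansion.

(** * Expansions at infinity and at zero *)

(* The boolean [b] says at which end a series is truncated: [b = true] for finitely
   many positive powers of y (f j = 0 for j << 0, expansions at y = oo), [b = false]
   for finitely many negative powers of y (f j = 0 for j >> 0, expansions at 0). *)
Section ExpansionAtBothEnds.
Variables (K : numFieldType) (z : K).
Implicit Types (b : bool) (m n l i j t : int) (f g : int -> K).

Definition far b t i := if b then i < t else t < i.

Definition bounded b f := exists t, forall i, far b t i -> f i = 0.

Definition step b i (k : nat) : int := if b then i - k%:Z else i + k%:Z.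

(** At infinity (y - z)^n is expanded in powers of z, at 0 as (-z + y)^n in powers of y. *)
Definition zcoef b n (k : nat) : K :=
  gbinom n k * (if b then (- z) ^+ k else (- z) ^ (n - k%:Z)).

(* Modes of (y - z)^n f(y), expanded at oo or at 0 according to [b]. *)
Definition zexp b n f j : K :=
  nsum (fun k : nat => zcoef b n k * f (step b (if b then j + n else j) k)).

Lemma bounded_step b f i :
  bounded b f -> exists K, forall k, (K <= k)%N -> f (step b i k) = 0.
Proof.
move=> [t f0]; exists (`|i - t|%N).+1 => k Kk; apply: f0.
by case: b; rewrite /far /step; lia.
Qed.

(** Both expansions are cases of [bexp] with a dummy variable and so inherit Pascal's rule; at 0 the
    constant -z plays the part of x, with modes (-z)^p. *)
Lemma zexpE b n f j :
  zexp b n f j = if b then bexp (- z) n (fun p _ => f p) j 0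
                 else bexp 1 n (fun p q => (- z) ^ p * f q) 0 j.
Proof.
case: b => //; apply: eq_nsum => k.
by rewrite /zcoef /= expr1n mulr1 mulrA add0r.
Qed.

Lemma zexp_ord b n f j (N : nat) :
    (forall k, (N <= k)%N -> f (step b (if b then j + n else j) k) = 0) ->
  zexp b n f j =
  \sum_(k < N) zcoef b n k * f (step b (if b then j + n else j) k).
Proof.
by move=> f0; apply: (@nsum_ord _ N) => k Nk; rewrite f0 ?mulr0.
Qed.

Lemma zexp_far b n f t j :
    (forall i, far b t i -> f i = 0) -> far b t (if b then j + n else j) ->
  zexp b n f j = 0.
Proof.
move=> f0 tj; apply: nsum0 => k; rewrite f0 ?mulr0 //.
by move: tj; case: b {f0}; rewrite /far /step; lia.
Qed.

Lemma zexp_eq0 b n f j : (forall i, f i = 0) -> zexp b n f j = 0.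
Proof. by move=> f0; apply: nsum0 => k; rewrite f0 mulr0. Qed.

Lemma eq_zexp b n f g : f =1 g -> zexp b n f =1 zexp b n g.
Proof. by move=> /funext ->. Qed.

Lemma zexp0 b f j : zexp b 0 f j = f j.
Proof. by rewrite zexpE; case: b; rewrite bexp0 // expr0z mul1r. Qed.

Lemma zexp_shift b n f j s : zexp b n (fun i => f (i + s)) j = zexp b n f (j + s).
Proof.
by apply: eq_nsum => k; congr (_ * f _); case: b; rewrite /step; lia.
Qed.

Lemma zexpB b n f g j : bounded b f -> bounded b g ->
  zexp b n (fun i => f i - g i) j = zexp b n f j - zexp b n g j.
Proof.
set i := if b then j + n else j.
move=> /(@bounded_step b f i)[n1 f0] /(@bounded_step b g i)[n2 g0].
rewrite !(@zexp_ord _ _ _ _ (maxn n1 n2)).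
- by rewrite -sumrB; apply: eq_bigr => k _; rewrite mulrBr.
- by move=> k; rewrite geq_max => /andP[_ ?]; apply: g0.
- by move=> k; rewrite geq_max => /andP[? _]; apply: f0.
- by move=> k; rewrite geq_max => /andP[? ?]; rewrite f0 ?g0 ?subr0.
Qed.

Lemma zexpZ b n f a j : bounded b f ->
  zexp b n (fun i => a * f i) j = a * zexp b n f j.
Proof.
move=> /(@bounded_step b f (if b then j + n else j))[n1 f0].
rewrite !(@zexp_ord _ _ _ _ n1) //.
- by rewrite mulr_sumr; apply: eq_bigr => k _ /=; rewrite mulrCA.
- by move=> k nk; rewrite f0 ?mulr0.
Qed.

Lemma zexpS b n f j : z != 0 -> bounded b f ->
  zexp b (n + 1) f j = zexp b n f (j + 1) - z * zexp b n f j.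
Proof.
move=> z0 bf; rewrite !zexpE; case: b bf => bf.
  rewrite bexp_Pascal ?mulNr //.
  by move=> p q; have [n0 f0] := bounded_step p bf; exists n0.
have supp : dsupp (fun p q => (- z) ^ p * f q).
  move=> p q; have [n0 f0] := bounded_step q bf.
  by exists n0 => k nk; rewrite (f0 k nk) mulr0.
rewrite bexp_Pascal // mul1r addrC -mulNr -bexpZ //; congr (_ + _).
apply: eq_nsum => k; congr (_ * _); rewrite mulrA; congr (_ * _).
rewrite (_ : 0 + 1 + n - k%:Z = 1 + (0 + n - k%:Z)); last by lia.
by rewrite expfzDr ?oppr_eq0.
Qed.

Definition shz f j := f (j + 1) - z * f j.

Lemma bounded_shift b f s : bounded b f -> bounded b (fun i => f (i + s)).
Proof.
move=> [t f0]; exists (t - s) => i ti; apply: f0.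
by move: ti; case: b; rewrite /far; lia.
Qed.

Lemma boundedB b f g :
  bounded b f -> bounded b g -> bounded b (fun i => f i - g i).
Proof.
move=> [t f0] [s g0]; exists (if b then Num.min t s else Num.max t s) => i ti.
by rewrite f0 ?g0 ?subr0 //; move: ti; case: b {f0 g0}; rewrite /far; lia.
Qed.

Lemma boundedZ b f a : bounded b f -> bounded b (fun i => a * f i).
Proof. by move=> [t f0]; exists t => i /f0 ->; rewrite mulr0. Qed.

Lemma bounded_shz b f : bounded b f -> bounded b (shz f).
Proof.
by move=> bf; apply: boundedB; [exact: bounded_shift|exact: boundedZ].
Qed.

Lemma zexp_iter b (n : nat) f : z != 0 -> bounded b f ->
  zexp b n f =1 iter n shz f.
Proof.
move=> z0 bf; elim: n => [|n IH] j /=; first by rewrite zexp0.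
by rewrite -addn1 PoszD zexpS // !IH.
Qed.

(** The recurrence f(j + 1) = z f(j) carries the zeros at small j upwards. This is how a factor y -
    z is cancelled. *)
Lemma shz_eq0 f : bounded true f -> (forall j, shz f j = 0) -> forall j, f j = 0.
Proof.
move=> [t f0] shf0 j.
have f0D (n : nat) : f (t - 1 + n%:Z) = 0.
  elim: n => [|n IH]; first by apply: f0; rewrite /far; lia.
  have /eqP := shf0 (t - 1 + n%:Z); rewrite subr_eq0 IH mulr0 => /eqP <-.
  by congr f; lia.
have [jt|tj] := boolP (j < t); first exact: f0.
by rewrite -(f0D (absz (j - t + 1))); congr f; lia.
Qed.

(** Joint finiteness in both summation indices, which allows the two sums in [zexp2] to be
    exchanged. *)
Definition jsupp (b1 b2 : bool) (g : int -> int -> K) := forall i j,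
  exists N, forall k1 k2, (N <= k1 + k2)%N -> g (step b1 i k1) (step b2 j k2) = 0.

Definition zexp2 b1 b2 m n (g : int -> int -> K) i j :=
  zexp b1 m (fun i => zexp b2 n (g i) j) i.

Lemma jsupp_ord b1 b2 m n (g : int -> int -> K) i j (N : nat) :
    (forall k1 k2, (N <= k1 + k2)%N ->
       g (step b1 (if b1 then i + m else i) k1)
         (step b2 (if b2 then j + n else j) k2) = 0) ->
  zexp2 b1 b2 m n g i j =
  \sum_(k1 < N) \sum_(k2 < N) zcoef b1 m k1 * (zcoef b2 n k2 *
    g (step b1 (if b1 then i + m else i) k1)
      (step b2 (if b2 then j + n else j) k2)).
Proof.
move=> g0; rewrite /zexp2 (@zexp_ord _ _ _ _ N).
  apply: eq_bigr => k1 _; rewrite (@zexp_ord _ _ _ _ N) ?mulr_sumr //.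
  by move=> k2 Nk; apply: g0; apply: leq_trans Nk (leq_addl _ _).
move=> k1 Nk; apply: nsum0 => k2; rewrite g0 ?mulr0 //.
exact: leq_trans Nk (leq_addr _ _).
Qed.

Lemma zexp2C b1 b2 m n (g : int -> int -> K) i j : jsupp b1 b2 g ->
  zexp2 b1 b2 m n g i j = zexp2 b2 b1 n m (fun j i => g i j) j i.
Proof.
move=> /(_ (if b1 then i + m else i) (if b2 then j + n else j))[N g0].
rewrite (jsupp_ord g0) exchange_big (@jsupp_ord _ _ _ _ _ _ _ N) /=.
  by do 2 !apply: eq_bigr => ? _; rewrite mulrCA.
by move=> k1 k2; rewrite addnC; apply: g0.
Qed.

Lemma zexp2Z b1 b2 m n (g : int -> int -> K) i j (a : K) : jsupp b1 b2 g ->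
  zexp2 b1 b2 m n (fun i j => a * g i j) i j = a * zexp2 b1 b2 m n g i j.
Proof.
move=> /(_ (if b1 then i + m else i) (if b2 then j + n else j))[N g0].
rewrite !(@jsupp_ord _ _ _ _ _ _ _ N) //.
  rewrite mulr_sumr; apply: eq_bigr => k1 _; rewrite mulr_sumr.
  by apply: eq_bigr => k2 _; ring.
by move=> k1 k2 /g0 ->; rewrite mulr0.
Qed.

Lemma zexp2B b1 b2 m n (g h : int -> int -> K) i j :
    jsupp b1 b2 g -> jsupp b1 b2 h ->
  zexp2 b1 b2 m n (fun i j => g i j - h i j) i j =
  zexp2 b1 b2 m n g i j - zexp2 b1 b2 m n h i j.
Proof.
set i0 := if b1 then i + m else i; set j0 := if b2 then j + n else j.
move=> /(_ i0 j0)[N1 g0] /(_ i0 j0)[N2 h0].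
rewrite !(@jsupp_ord _ _ _ _ _ _ _ (maxn N1 N2)).
- rewrite -sumrB; apply: eq_bigr => k1 _; rewrite -sumrB.
  by apply: eq_bigr => k2 _; rewrite !mulrBr.
- by move=> k1 k2; rewrite geq_max => /andP[_ ?]; apply: h0.
- by move=> k1 k2; rewrite geq_max => /andP[? _]; apply: g0.
- by move=> k1 k2; rewrite geq_max => /andP[? ?]; rewrite g0 ?h0 ?subr0.
Qed.

End ExpansionAtBothEnds.

(** * Powers of x - y *)

Section DoubleSeries.
Variables (K : numFieldType) (z : K).
Implicit Types (b : bool) (m n l i j t : int) (g h : int -> int -> K).

(* Pascal's rule determines a function of [l] from its value at 0, in the
   negative direction thanks to truncation. *)
Lemma Pascal_unique b (c : K) (D : int -> int -> int -> K) : c != 0 ->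
    (forall l i j, D (l + 1) i j = D l (i + 1) j + c * D l i (j + 1)) ->
    (forall i j, D 0 i j = 0) ->
    (forall l, exists t, forall i j, far b t i -> D l i j = 0) ->
  forall l i j, D l i j = 0.
Proof.
move=> c0 DS D0 Dfar.
have Dnat (n : nat) i j : D n%:Z i j = 0.
  elim: n i j => [|n IH] i j; first exact: D0.
  by rewrite -addn1 PoszD DS !IH mulr0 addr0.
suff Dneg (n : nat) i j : D (- n%:Z) i j = 0.
  move=> l i j; have [l0|/ltW l0] := leP 0 l.
    by rewrite -(gez0_abs l0) Dnat.
  by rewrite -[l]opprK -(lez0_abs l0) Dneg.
elim: n i j => [|n IH]; first exact: D0.
set l := - n.+1%:Z.
have Dl i j : D l (i + 1) j = - c * D l i (j + 1).
  apply/eqP; rewrite mulNr -addr_eq0 -DS.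
  by rewrite (_ : l + 1 = - n%:Z) ?IH //; rewrite /l; lia.
(* [Dl] ties the values along an antidiagonal: vanishing for small i is carried upwards, vanishing
   for large i downwards, the latter by dividing by c. *)
have [t Dt] := Dfar l; case: b {Dfar} Dt => Dt i j.
  have DtD (k : nat) i' j' : i' < t + k%:Z -> D l i' j' = 0.
    elim: k i' j' => [|k IHk] i' j' ik; first by apply: Dt; rewrite /far; lia.
    rewrite (_ : i' = i' - 1 + 1); last by lia.
    by rewrite Dl IHk ?mulr0 //; lia.
  by apply: (DtD (absz (i - t + 1))); lia.
have DtD (k : nat) i' j' : t - k%:Z < i' -> D l i' j' = 0.
  elim: k i' j' => [|k IHk] i' j' ik; first by apply: Dt; rewrite /far; lia.
  have /eqP := Dl i' (j' - 1); rewrite subrK IHk; last by lia.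
  by rewrite eq_sym mulf_eq0 oppr_eq0 (negPf c0) => /eqP.
by apply: (DtD (absz (t - i + 1))); lia.
Qed.

(* Modes of (x - y)^l g(x, y), expanded in nonnegative powers of y if [b] and
   of x otherwise. *)
Definition dexp b l g i j : K :=
  if b then bexp (-1) l g i j
  else (-1) ^ l * bexp (-1) l (fun j i => g i j) j i.

Definition dsuppb b g := if b then dsupp g else dsupp (fun j i => g i j).

Lemma signzS l : (-1) ^ (l + 1) = - (-1) ^ l :> K.
Proof. by rewrite expfzDr ?oppr_eq0 ?oner_eq0 // mulrN1. Qed.

Lemma signzK l : (-1) ^ l * (-1) ^ l = 1 :> K.
Proof. by rewrite -expfzMl mulrNN mulr1 exp1rz. Qed.

Lemma dexpC b l g i j :
  (-1) ^ l * dexp b l (fun j i => g i j) j i = dexp (~~ b) l g i j.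
Proof. by case: b => //=; rewrite mulrA signzK mul1r. Qed.

Lemma dexp0 b g i j : dexp b 0 g i j = g i j.
Proof. by case: b; rewrite /= bexp0 // mul1r. Qed.

Lemma dexpS b l g i j : dsuppb b g ->
  dexp b (l + 1) g i j = dexp b l g (i + 1) j - dexp b l g i (j + 1).
Proof.
case: b => gs; rewrite /dexp /= bexp_Pascal // ?mulN1r //.
by rewrite signzS mulrBr !mulNr addrC opprK.
Qed.

Lemma dexp_shift b l g i j s t :
  dexp b l (fun i j => g (i + s) (j + t)) i j = dexp b l g (i + s) (j + t).
Proof.
case: b; rewrite /= ?bexp_shift //; congr (_ * _).
exact: (bexp_shift _ _ (fun j i => g i j)).
Qed.

Lemma dexpB b l g h i j : dsuppb b g -> dsuppb b h ->
  dexp b l (fun i j => g i j - h i j) i j = dexp b l g i j - dexp b l h i j.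
Proof.
case: b => gs hs; rewrite /dexp /= (bexpB _ _ _ _ gs hs) //.
exact: mulrBr.
Qed.

Lemma dexpZ b l g a i j : dsuppb b g ->
  dexp b l (fun i j => a * g i j) i j = a * dexp b l g i j.
Proof.
case: b => gs; rewrite /dexp /= (bexpZ _ _ _ _ _ gs) //.
exact: mulrCA.
Qed.

(** The shape of iterated modes: the operator acting first has one bound, the second a bound
    depending on the vector produced by the first. *)
Definition ubounded b1 b2 g :=
  (exists t, forall i, far b1 t i -> forall j, g i j = 0) /\
  forall i, bounded b2 (g i).

Lemma ubounded_dsupp b1 b2 g : ubounded b1 b2 g -> dsuppb b1 g.
Proof.
move=> [[t g0] _]; case: b1 g0 => g0 p q.
  by exists (absz (p - t + 1)) => k kn; apply: g0; rewrite /far; lia.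
by exists (absz (t - q + 1)) => k kn; apply: g0; rewrite /far; lia.
Qed.

Lemma ubounded_jsupp b1 b2 g : ubounded b1 b2 g -> jsupp b1 b2 g.
Proof.
move=> [[t g0] gb] i j.
have [n0 n0P] : exists n0 : nat, forall k, (n0 <= k)%N -> forall j, g (step b1 i k) j = 0.
  exists (`|i - t|%N).+1 => k Kk; apply: g0.
  by case: b1; rewrite /far /step; lia.
have [N NP] : exists N : nat, forall k1 k2, (k1 < n0)%N -> (N <= k2)%N ->
    g (step b1 i k1) (step b2 j k2) = 0.
  elim: n0 {n0P} => [|n0 [N IH]]; first by exists 0%N.
  have [N' N'P] := bounded_step j (gb (step b1 i n0)).
  exists (maxn N N') => k1 k2; rewrite ltnS leq_eqVlt geq_max => k12 /andP[? ?].
  by case/orP: k12 => [/eqP ->|?]; [exact: N'P|exact: IH].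
exists (n0 + N)%N => k1 k2 nk; have [/n0P -> //|k1n] := leqP n0 k1.
by apply: NP => //; lia.
Qed.

Lemma dexp_far b l g t i j :
    (forall i, far b t i -> forall j, g i j = 0) ->
    far b t (if b then i + l else i) ->
  dexp b l g i j = 0.
Proof.
move=> g0; case: b g0 => g0 /= ti.
  by apply: bexp_eq0 => k; apply: g0; rewrite /far; lia.
by rewrite bexp_eq0 ?mulr0 // => k; apply: g0; move: ti; rewrite /far; lia.
Qed.

Lemma bounded_sum b (f : nat -> int -> K) (N : nat) :
    (forall k, bounded b (f k)) ->
  bounded b (fun j => \sum_(k < N) f k j).
Proof.
move=> fb; elim: N => [|N [t IH]].
  by exists 0 => j _; rewrite big_ord0.
have [s f0] := fb N.
exists (if b then Num.min t s else Num.max t s) => i ti.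
rewrite big_ord_recr /= IH ?f0 ?addr0 //; move: ti;
by case: b {fb f0 IH}; rewrite /far; lia.
Qed.

(** For fixed i the bound in the first index leaves finitely many terms of (x - y)^l, each a shifted
    series bounded in j. *)
Lemma ubounded_dexp b1 b2 l g : ubounded b1 b2 g -> ubounded b1 b2 (dexp b1 l g).
Proof.
move=> [[t g0] gb]; split.
  exists (if b1 then t - l else t) => i ti j; apply: (dexp_far _ g0).
  by move: ti; case: b1 {g0}; rewrite /far; lia.
move=> i; case: b1 g0 => g0 /=.
  rewrite (_ : dexp true l g i = fun j => \sum_(k < absz (i + l - t + 1))
    gbinom l k * (-1) ^+ k * g (i + l - k%:Z) (j + k%:Z)).
    apply: (bounded_sum (f := fun k j => gbinom l k * (-1) ^+ k *
      g (i + l - k%:Z) (j + k%:Z))) => k.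
    by apply: boundedZ; apply: (bounded_shift _ (gb _)).
  apply: funext => j; apply: bexp_ord => k kn; apply: g0.
  by rewrite /far; lia.
rewrite (_ : dexp false l g i = fun j => (-1) ^ l * \sum_(k < absz (t - i + 1))
  gbinom l k * (-1) ^+ k * g (i + k%:Z) (j + (l - k%:Z))).
  apply: boundedZ; apply: (bounded_sum (f := fun k j => gbinom l k *
    (-1) ^+ k * g (i + k%:Z) (j + (l - k%:Z)))) => k.
  by apply: boundedZ; apply: (bounded_shift _ (gb _)).
apply: funext => j; congr (_ * _).
rewrite (@bexp_ord _ _ _ _ _ _ (absz (t - i + 1))).
  by apply: eq_bigr => k _; rewrite addrA.
by move=> k kn; apply: g0; rewrite /far; lia.
Qed.

Lemma zexp_dexpS b1 b2 l n g i j : ubounded b1 b2 g ->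
  zexp z b2 n (dexp b1 (l + 1) g i) j =
  zexp z b2 n (dexp b1 l g (i + 1)) j - zexp z b2 n (dexp b1 l g i) (j + 1).
Proof.
move=> bg; have [_ bl] := ubounded_dexp l bg.
rewrite -zexp_shift -zexpB //; last exact: bounded_shift.
by apply: eq_zexp => j1; apply: dexpS; apply: ubounded_dsupp bg.
Qed.

(* On the left the sum over k in (x - y)^l is finite only because [vanish] cuts off
   the difference of the two inner terms; on the right each term makes sense alone. *)
Lemma split_iterated b (gt gf : int -> int -> K) (M : int) l m n i j :
    z != 0 -> ubounded b true gt -> ubounded b false gf ->
    (forall n i j, M <= n -> zexp z true n (gt i) j = zexp z false n (gf i) j) ->
  bexp (-1) l (fun m n =>
    zexp z b m (fun i => zexp z true n (gt i) j - zexp z false n (gf i) j) i) m n =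
  zexp2 z b true m n (dexp b l gt) i j - zexp2 z b false m n (dexp b l gf) i j.
Proof.
move=> z0 bt bf vanish.
pose I (u v : int -> int -> K) n i j :=
  zexp z true n (u i) j - zexp z false n (v i) j.
pose R m n i j := zexp z b m (fun i => I gt gf n i j) i.
have Ib u v n' j' :
    ubounded b true u -> ubounded b false v -> bounded b (fun i => I u v n' i j').
  move=> [[t u0] _] [[s v0] _].
  by apply: boundedB; [exists t|exists s] => i' far_i; apply: zexp_eq0;
    [exact: u0|exact: v0].
(* Raising m multiplies by x - z, raising n by y - z. As (x - z) - (y - z) = x - y, the difference
   of the two rules yields Pascal's rule in l. *)
have Rx m' n' i' j' : R (m' + 1) n' i' j' = R m' n' (i' + 1) j' - z * R m' n' i' j'.
  by rewrite /R zexpS //; apply: Ib.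
have Ry m' n' i' j' : R m' (n' + 1) i' j' = R m' n' i' (j' + 1) - z * R m' n' i' j'.
  rewrite /R -zexpZ; last exact: Ib.
  rewrite -zexpB; [|exact: Ib|by apply: boundedZ; apply: Ib].
  apply: eq_zexp => i1; rewrite /I !zexpS //; [|by case: bf|by case: bt].
  by ring.
have Rsupp i' j' : dsupp (fun m n => R m n i' j').
  move=> m' n'; exists (absz (M - n')) => k kn; apply: zexp_eq0 => i1.
  by rewrite /I vanish ?subrr //; lia.
(* [Q] multiplies by (x - y)^l inside the residue, instead of expanding it through m and n. *)
pose Q l i j := zexp z b m (fun i => I (dexp b l gt) (dexp b l gf) n i j) i.
have QE : Q l i j =
    zexp2 z b true m n (dexp b l gt) i j - zexp2 z b false m n (dexp b l gf) i j.
  have [bt' bf'] := (ubounded_dexp l bt, ubounded_dexp l bf).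
  rewrite /Q /I zexpB //.
    by have [[t u0] _] := bt'; exists t => i' /u0 ?; apply: zexp_eq0.
  by have [[t u0] _] := bf'; exists t => i' /u0 ?; apply: zexp_eq0.
rewrite -QE; apply/eqP; rewrite -subr_eq0; apply/eqP.
pose D l i j := bexp (-1) l (fun m n => R m n i j) m n - Q l i j.
apply: (@Pascal_unique b (-1) D); first by rewrite oppr_eq0 oner_eq0.
- move=> l' i' j'; pose R0 m n := R m n i' j'.
  have E1 : bexp (-1) l' R0 (m + 1) n - bexp (-1) l' R0 m (n + 1) =
      bexp (-1) l' (fun m n => R m n (i' + 1) j') m n -
      bexp (-1) l' (fun m n => R m n i' (j' + 1)) m n.
    have -> : bexp (-1) l' R0 (m + 1) n = bexp (-1) l' (fun m n => R0 (m + 1) (n + 0)) m n.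
      by rewrite bexp_shift addr0.
    have -> : bexp (-1) l' R0 m (n + 1) = bexp (-1) l' (fun m n => R0 (m + 0) (n + 1)) m n.
      by rewrite bexp_shift addr0.
    rewrite -!bexpB //.
    + by apply: eq_bexp => k; rewrite /R0 !addr0 Rx Ry; ring.
    + exact: dsupp_shift (Rsupp i' j').
    + exact: dsupp_shift (Rsupp i' j').
  have E2 : Q (l' + 1) i' j' = Q l' (i' + 1) j' - Q l' i' (j' + 1).
    have [bt' bf'] := (ubounded_dexp l' bt, ubounded_dexp l' bf).
    pose I' i j := I (dexp b l' gt) (dexp b l' gf) n i j.
    have -> : Q l' (i' + 1) j' = zexp z b m (fun i => I' (i + 1) j') i'.
      by rewrite (zexp_shift z b m (fun i => I' i j')).
    rewrite -zexpB; first last.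
    - exact: Ib.
    - by apply: (bounded_shift (f := fun i => I' i j')); apply: Ib.
    apply: eq_zexp => i1; rewrite /I' /I (zexp_dexpS _ _ _ _ bt).
    by rewrite (zexp_dexpS _ _ _ _ bf); ring.
  rewrite /D bexp_Pascal // -/R0 mulN1r E1 E2; ring.
- move=> i' j'; rewrite /D bexp0 /Q /R; apply/eqP; rewrite subr_eq0; apply/eqP.
  by apply: eq_zexp => i1; rewrite /I; congr (_ - _);
    apply: eq_zexp => j1; rewrite dexp0.
- move=> l'; have [[[t gt0] _] [[s gf0] _]] := (bt, bf).
  pose r := if b then Num.min t s else Num.max t s.
  exists (if b then r - m - l' else r) => i' j' far_i.
  have I0 n1 j1 i1 : far b r i1 -> I gt gf n1 i1 j1 = 0.
    move=> ri; rewrite /I !zexp_eq0 ?subr0 //; [apply: gf0|apply: gt0];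
    by move: ri; rewrite /r /far; case: (b); lia.
  have I0' i1 : far b (if b then r - l' else r) i1 ->
      I (dexp b l' gt) (dexp b l' gf) n i1 j' = 0.
    move=> ri; rewrite /I !zexp_eq0 ?subr0 // => j1;
    [apply: (dexp_far _ gf0)|apply: (dexp_far _ gt0)];
    by move: ri; rewrite /r /far; case: (b); lia.
  rewrite /D /Q (zexp_far _ I0'); last first.
    by move: far_i; rewrite /far; case: (b); lia.
  rewrite subr0; apply: bexp_eq0 => k; apply: (zexp_far _ (I0 _ _)).
  by move: far_i; rewrite /far; case: (b); lia.
Qed.

End DoubleSeries.

(** * Iterates and the substitution x = y + x0 *)

Section Iterates.
Variables (K : numFieldType) (z : K).
Implicit Types (b : bool) (m n l i j t : int) (a g h : int -> int -> K).

(* If [a l] gives the modes of the l-th product u_l v, then [diter a l i j] is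
   Res_{x0} Res_y x0^l (y + x0)^i y^j Y(Y(u, x0)v, y), the iterate side of the
   Jacobi identity. *)
Definition diter a l i j := bexp 1 i (fun p q => a q p) j l.

Definition iterable b a :=
  (forall l, bounded b (a l)) /\ exists L, forall l, L <= l -> forall j, a l j = 0.

Lemma iterable_dsupp b a : iterable b a -> dsupp (fun p q => a q p).
Proof.
by move=> [_ [L a0]] p q; exists (absz (L - q)) => k Lk; apply: a0; lia.
Qed.

Lemma diter0 a l j : diter a l 0 j = a l j.
Proof. exact: bexp0. Qed.

Lemma diterS b a l i j : iterable b a ->
  diter a l (i + 1) j = diter a l i (j + 1) + diter a (l + 1) i j.
Proof. by move=> /iterable_dsupp sa; rewrite /diter bexp_Pascal // mul1r. Qed.

(** The k-th term involves [a] at l + k and i + j - k, and only k < L - l contribute: finitely many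
    bounds combine into one on i + j. *)
Lemma diter_far b a l : iterable b a ->
  exists s, forall i j, far b s (i + j) -> diter a l i j = 0.
Proof.
move=> [ab [L a0]].
suff [s sP] : exists s, forall k : nat, (k < absz (L - l))%N ->
    forall x, far b s x -> a (l + k%:Z) (x - k%:Z) = 0.
  exists s => i j sij; apply: bexp_eq0 => k.
  have [kL|kL] := ltnP k (absz (L - l)); last by apply: a0; lia.
  by rewrite (addrC j); apply: sP.
elim: (absz _) => [|N [s sP]]; first by exists 0.
have [t tP] := bounded_shift (- N%:Z) (ab (l + N%:Z)).
exists (if b then Num.min t s else Num.max t s) => k; rewrite ltnS leq_eqVlt.
case/orP => [/eqP ->|kN] x far_x; first apply: tP; last apply: sP => //;
by move: far_x; rewrite /far; case: (b); lia.
Qed.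

(** Under x = y + x0 the factor (x - z)^m becomes ((y - z) + x0)^m, expanded in x0. Both sides obey
    Pascal's rule in m and vanish for large l. *)
Lemma zexp2_diter b a l m n j : z != 0 -> iterable b a ->
  zexp2 z b b m n (diter a l) 0 j = bexp 1 m (fun p q => zexp z b p (a q) j) n l.
Proof.
move=> z0 ia; have [ab [L a0]] := ia.
have bdj l' i' : bounded b (diter a l' i').
  have [s sP] := diter_far l' ia; exists (s - i') => j' sj; apply: sP.
  by move: sj; rewrite /far; case: (b); lia.
have bdi l' n' j' : bounded b (fun i => zexp z b n' (diter a l' i) j').
  have [s sP] := diter_far l' ia.
  exists (s - (if b then j' + n' else j')) => i' far_i.
  apply: (@zexp_far _ _ _ _ _ (s - i')).
    by move=> i1 far_i1; apply: sP; move: far_i1; rewrite /far; case: (b); lia.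
  by move: far_i; rewrite /far; case: (b); lia.
pose D m l n := zexp2 z b b m n (diter a l) 0 j - bexp 1 m (fun p q => zexp z b p (a q) j) n l.
suff /(_ m l n) /eqP : forall m l n, D m l n = 0 by rewrite subr_eq0 => /eqP.
apply: (@Pascal_unique _ false 1); first exact: oner_neq0.
- move=> m' l' n'; rewrite /D bexp_Pascal; last first.
    move=> p q; exists (absz (L - q)) => k Lk; apply: zexp_eq0 => j'.
    by apply: a0; lia.
  pose F i j := zexp z b n' (diter a l' i) j.
  suff : zexp2 z b b m' n' (diter a (l' + 1)) 0 j =
      zexp z b m' (fun i => F (i + 1) j) 0 - zexp z b m' (fun i => F i (j + 1)) 0.
    rewrite (zexp_shift z b m' (fun i => F i j)) => ->.
    rewrite /zexp2 (zexpS _ _ z0 (bdi l' n' j)).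
    have -> : zexp z b m' (fun i => zexp z b (n' + 1) (diter a l' i) j) 0 =
        zexp z b m' (fun i => F i (j + 1)) 0 - z * zexp z b m' (fun i => F i j) 0.
      rewrite -zexpZ; last exact: bdi.
      rewrite -zexpB; [|exact: bdi|by apply: boundedZ; exact: bdi].
      by apply: eq_zexp => i; rewrite zexpS.
    by rewrite /F; ring.
  rewrite -zexpB; last exact: bdi.
    apply: eq_zexp => i; rewrite /F -zexp_shift -zexpB //.
      by apply: eq_zexp => j'; rewrite (diterS _ _ _ ia); ring.
    exact: bounded_shift.
  exact: (bounded_shift 1 (bdi l' n' j)).
- move=> l' n'; rewrite /D bexp0 /zexp2 zexp0; apply/eqP.
  by rewrite subr_eq0; apply/eqP/eq_zexp => j'; rewrite diter0.
- move=> m'; exists L => l' n' Ll; rewrite /D bexp_eq0 ?subr0.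
    move: Ll; rewrite /far => Ll; apply: zexp_eq0 => i; apply: zexp_eq0 => j'.
    by apply: bexp_eq0 => k; apply: a0; lia.
  by move: Ll; rewrite /far => Ll k; apply: zexp_eq0 => j'; apply: a0; lia.
Qed.

End Iterates.

(** * Transporting the Jacobi identity *)

Section Torsion.
Variables (K : numFieldType) (z : K).
Implicit Types (b : bool) (m n l i j t : int) (a g h : int -> int -> K).

Definition shx g i j := g (i + 1) j - z * g i j.
Definition shy g i j := g i (j + 1) - z * g i j.

(* Killed by a power of (x - z) times a power of (y - z). *)
Inductive torsion g : Prop :=
| torsion0 of forall i j, g i j = 0
| torsionx of torsion (shx g)
| torsiony of torsion (shy g).

Lemma shxyC g : shx (shy g) = shy (shx g).
Proof. by apply/funext => i; apply/funext => j; rewrite /shx /shy; ring. Qed.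

Lemma torsion_shx g : torsion g -> torsion (shx g).
Proof.
elim=> {}g => [g0|//|_ IH]; last by apply: torsiony; rewrite -shxyC.
by apply: torsion0 => i j; rewrite /shx !g0 mulr0 subr0.
Qed.

Lemma torsion_shy g : torsion g -> torsion (shy g).
Proof.
elim=> {}g => [g0|_ IH|//]; last by apply: torsionx; rewrite shxyC.
by apply: torsion0 => i j; rewrite /shy !g0 mulr0 subr0.
Qed.

(** Induction on g, then on h: a factor needed for g may be applied to the whole difference, since h
    stays torsion under it. *)
Lemma torsionB g h :
  torsion g -> torsion h -> torsion (fun i j => g i j - h i j).
Proof.
move=> gt; elim: gt h => {}g => [g0|_ IH|_ IH] h ht.
- elim: ht g g0 => {}h => [h0|_ IH|_ IH] g g0.
  + by apply: torsion0 => i j; rewrite g0 h0 subr0.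
  + apply: torsionx; have -> : shx (fun i j => g i j - h i j) =
        fun i j => shx g i j - shx h i j.
      by apply/funext => i; apply/funext => j; rewrite /shx; ring.
    by apply: IH => i j; rewrite /shx !g0 mulr0 subr0.
  + apply: torsiony; have -> : shy (fun i j => g i j - h i j) =
        fun i j => shy g i j - shy h i j.
      by apply/funext => i; apply/funext => j; rewrite /shy; ring.
    by apply: IH => i j; rewrite /shy !g0 mulr0 subr0.
- apply: torsionx; have -> : shx (fun i j => g i j - h i j) =
      fun i j => shx g i j - shx h i j.
    by apply/funext => i; apply/funext => j; rewrite /shx; ring.
  by apply: IH; apply: torsion_shx.
- apply: torsiony; have -> : shy (fun i j => g i j - h i j) =
      fun i j => shy g i j - shy h i j.
    by apply/funext => i; apply/funext => j; rewrite /shy; ring.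
  by apply: IH; apply: torsion_shy.
Qed.

Lemma torsionD g h :
  torsion g -> torsion h -> torsion (fun i j => g i j + h i j).
Proof.
move=> gt ht; have -> : (fun i j => g i j + h i j) =
    fun i j => g i j - (0 - h i j).
  by apply/funext => i; apply/funext => j; rewrite sub0r opprK.
by apply: torsionB => //; apply: (torsionB (g := fun _ _ => 0)) => //; apply: torsion0.
Qed.

Lemma torsion_iter_shy (N : nat) g :
  (forall i j, iter N (shz z) (g i) j = 0) -> torsion g.
Proof.
elim: N g => [|N IH] g g0; first exact: torsion0.
by apply/torsiony/IH => i j; rewrite -(g0 i j) iterSr.
Qed.

Lemma torsion_iter_shx (N : nat) g :
  (forall i j, iter N (shz z) (fun i => g i j) i = 0) -> torsion g.
Proof.
elim: N g => [|N IH] g g0; first exact: torsion0.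
by apply/torsionx/IH => i j; rewrite -(g0 i j) iterSr.
Qed.

Definition bounded2 g :=
  (forall i, bounded true (g i)) /\ (forall j, bounded true (fun i => g i j)).

(** The factors x - z and y - z are cancelled one by one with [shz_eq0]; multiplication by them
    preserves [bounded2]. *)
Lemma torsion_eq0 g : torsion g -> bounded2 g -> forall i j, g i j = 0.
Proof.
elim=> {}g // _ IH [gy gx] i j.
  apply: (@shz_eq0 _ z (fun i => g i j)) => // {}i; apply: IH; split=> [{}i|{}j].
    by apply: boundedB => //; apply: boundedZ.
  exact: bounded_shz.
apply: (@shz_eq0 _ z (g i)) => // {}j; apply: IH; split=> [{}i|{}j].
  exact: bounded_shz.
by apply: boundedB => //; apply: boundedZ.
Qed.

Lemma dsuppb_sh b g : dsuppb b g -> dsuppb b (shx g) /\ dsuppb b (shy g).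
Proof.
by case: b => gs; split=> p q;
  [have [N1 g1] := gs (p + 1) q|have [N1 g1] := gs p (q + 1)|
   have [N1 g1] := gs p (q + 1)|have [N1 g1] := gs (p + 1) q];
  have [N2 g2] := gs p q; exists (maxn N1 N2) => k; rewrite geq_max => /andP[k1 k2];
  rewrite /shx /shy (g2 _ k2) mulr0 subr0 -(g1 _ k1); congr (g _ _); lia.
Qed.

Lemma dsuppb_shift b g s t : dsuppb b g -> dsuppb b (fun i j => g (i + s) (j + t)).
Proof.
case: b; first exact: dsupp_shift.
exact: (@dsupp_shift _ (fun j i => g i j) t s).
Qed.

Lemma dsuppbZ b g (c : K) : dsuppb b g -> dsuppb b (fun i j => c * g i j).
Proof.
by case: b => gs p q; have [N gN] := gs p q; exists N => k /gN ->; rewrite mulr0.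
Qed.

Lemma dexp_shx b l g : dsuppb b g -> dexp b l (shx g) = shx (dexp b l g).
Proof.
move=> gs; apply/funext => i; apply/funext => j.
have -> : shx g = fun i j => g (i + 1) (j + 0) - z * g i j.
  by apply/funext => i'; apply/funext => j'; rewrite addr0.
rewrite dexpB ?dexpZ ?dexp_shift ?addr0 //; first exact: dsuppb_shift.
exact: dsuppbZ.
Qed.

Lemma dexp_shy b l g : dsuppb b g -> dexp b l (shy g) = shy (dexp b l g).
Proof.
move=> gs; apply/funext => i; apply/funext => j.
have -> : shy g = fun i j => g (i + 0) (j + 1) - z * g i j.
  by apply/funext => i'; apply/funext => j'; rewrite addr0.
rewrite dexpB ?dexpZ ?dexp_shift ?addr0 //; first exact: dsuppb_shift.
exact: dsuppbZ.
Qed.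

(** Powers of x - y commute with multiplication by x - z and by y - z. *)
Lemma torsion_dexp b l g : torsion g -> dsuppb b g -> torsion (dexp b l g).
Proof.
elim=> {}g => [g0|_ IH|_ IH] gs.
- apply: torsion0 => i j; case: b gs => _; rewrite /dexp bexp_eq0 ?mulr0 //.
- by apply: torsionx; rewrite -dexp_shx //; apply: IH; case: (dsuppb_sh gs).
- by apply: torsiony; rewrite -dexp_shy //; apply: IH; case: (dsuppb_sh gs).
Qed.

Lemma torsion_dexpB b l g h : dsuppb b g -> dsuppb b h ->
    torsion (fun i j => g i j - h i j) ->
  torsion (fun i j => dexp b l g i j - dexp b l h i j).
Proof.
move=> gs hs gh; have -> : (fun i j => dexp b l g i j - dexp b l h i j) =
    dexp b l (fun i j => g i j - h i j).
  by apply/funext => i; apply/funext => j; rewrite dexpB.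
apply: torsion_dexp gh _.
by case: b gs hs => gs hs p q; have [N1 g1] := gs p q; have [N2 h2] := hs p q;
  exists (maxn N1 N2) => k; rewrite geq_max => /andP[/g1 -> /h2 ->]; rewrite subr0.
Qed.

Lemma iter_shzB (N : nat) (f1 f2 : int -> K) j :
  iter N (shz z) (fun j => f1 j - f2 j) j =
  iter N (shz z) f1 j - iter N (shz z) f2 j.
Proof. by elim: N j => //= N IH j; rewrite /shz !IH; ring. Qed.

Lemma iter_shz0 (N : nat) (f : int -> K) j :
  (forall j, f j = 0) -> iter N (shz z) f j = 0.
Proof. by move=> f0; elim: N j => //= N IH j; rewrite /shz !IH mulr0 subr0. Qed.

Lemma torsion_diter a l :
    (exists L, forall l, L <= l -> forall j, a l j = 0) ->
    (forall l, exists N : nat, forall j, iter N (shz z) (a l) j = 0) ->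
  torsion (diter a l).
Proof.
move=> [L aL] aN.
(* [diter a l] involves only indices l' >= l, and from L on [a] vanishes, so finitely many exponents
   have to be bounded together. *)
have [N] : exists N : nat, forall l', l <= l' -> forall j, iter N (shz z) (a l') j = 0.
  suff [N NP] : exists N : nat, forall k : nat, (k < absz (L - l))%N ->
      forall j, iter N (shz z) (a (l + k%:Z)) j = 0.
    exists N => l' ll' j; have [L'|l'L] := leP L l'.
      by apply: iter_shz0 => {}j; apply: aL.
    by rewrite (_ : l' = l + (absz (l' - l))%:Z) ?NP //; lia.
  elim: (absz _) => [|n [N NP]]; first by exists 0%N.
  have [N' N'P] := aN (l + n%:Z).
  exists (N + N')%N => k; rewrite ltnS leq_eqVlt => /orP[/eqP ->|kn] j.
    by rewrite iterD; apply: iter_shz0.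
  by rewrite addnC iterD; apply: iter_shz0; apply: NP.
elim: N a aL {aN} => [|N IH] a aL aN.
  by apply: torsion0 => i j; apply: bexp_eq0 => k; apply: (aN (l + k%:Z)); lia.
have da : dsupp (fun p q => a q p).
  by move=> p q; exists (absz (L - q)) => k Lk; apply: aL; lia.
(* Multiplication by y - z commutes with (y + x0)^i, so it may be applied to each [a l]
   separately. *)
apply: torsiony; have -> : shy (diter a l) = diter (fun l => shz z (a l)) l.
  apply/funext => i; apply/funext => j.
  rewrite /shy /diter -bexpZ // -{1}[l]addr0 -(bexp_shift _ _ (fun p q => a q p)).
  rewrite -bexpB; [|exact: (dsupp_shift 1 0 da)|].
    by apply: eq_bexp => k; rewrite addr0.
  by move=> p q; have [N1 aN1] := da p q; exists N1 => k /aN1 ->; rewrite mulr0.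
apply: IH => [l' Ll' j|l' ll' j]; first by rewrite /shz !aL ?mulr0 ?subr0.
by rewrite -iterSr; apply: aN.
Qed.

End Torsion.

(** * The Jacobi identity for double residues *)

Section Assembly.
Variables (K : numFieldType) (z : K).
Hypothesis z0 : z != 0.
Implicit Types (b : bool) (m n l i j t : int) (a g h : int -> int -> K).

Definition swap g : int -> int -> K := fun j i => g i j.

(* [gt] and [gf] are expansions, at y = oo and at y = 0, of one family of
   rational functions of y with a pole of bounded order at z. *)
Definition local b gt gf := [/\ ubounded b true gt, ubounded b false gf &
  exists M, forall n i j, M <= n -> zexp z true n (gt i) j = zexp z false n (gf i) j].

Lemma iter_local (gt gf : int -> K) :
    bounded true gt -> bounded false gf ->
    (exists M, forall n j, M <= n -> zexp z true n gt j = zexp z false n gf j) ->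
  exists N : nat, forall j, iter N (shz z) (fun j => gt j - gf j) j = 0.
Proof.
move=> bt bf [M MP]; exists (absz M) => j.
rewrite iter_shzB -(zexp_iter _ z0 bt) -(zexp_iter _ z0 bf) MP ?subrr //; lia.
Qed.

Lemma local_iter b gt gf : local b gt gf ->
  exists N : nat, forall i j, iter N (shz z) (fun j => gt i j - gf i j) j = 0.
Proof.
move=> [[_ bt] [_ bf] [M MP]]; exists (absz M) => i j.
rewrite iter_shzB -(zexp_iter _ z0 (bt i)) -(zexp_iter _ z0 (bf i)).
by rewrite MP ?subrr //; lia.
Qed.

Section Jacobi.
(** In each double series i is the mode of u and j that of v. The first letter tells whether u acts
    on the side of W_1 (A) or W_2 (B), the second tells this for v. When both act on the same side,
    u acts first without a prime and v with one. [a l] and [c l] are the modes of u_l v on the two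
    sides. *)
Variables (AA AB BA BB AA' BB' a c : int -> int -> K).
Hypothesis locA : local true AA AB.
Hypothesis locB : local false BA BB.
Hypothesis locA' : local true (swap AA') (swap BA).
Hypothesis locB' : local false (swap AB) (swap BB').
Hypothesis iter_a : iterable true a.
Hypothesis iter_c : iterable false c.
Hypothesis loc_ac : forall l, exists M, forall n j, M <= n ->
  zexp z true n (a l) j = zexp z false n (c l) j.
Hypothesis jacobi_c :
  forall l i j, dexp true l BB' i j - dexp false l BB i j = diter c l i j.

(* The difference of the two sides is torsion, because the six series are
   expansions of one rational function and [jacobi_c] holds; being bounded
   below in each mode, it vanishes. *)
Lemma jacobi_a l i j : dexp true l AA i j - dexp false l AA' i j = diter a l i j.
Proof.
have [uAA uAB _] := locA; have [uBA uBB _] := locB.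
have [uAA' uBA' _] := locA'; have [uAB' uBB' _] := locB'.
have [ab [L aL]] := iter_a; have [cb [L' cL']] := iter_c.
have sAA' : dsuppb false AA' := ubounded_dsupp uAA'.
have sBB' : dsuppb true BB' := ubounded_dsupp uBB'.
(* The chain AA, AB, BB' links the terms expanded in powers of y, the chain AA', BA, BB those
   expanded in powers of x. Neighbours differ by torsion, from locality in one of the variables. *)
have tor1 : torsion z (fun i j => dexp true l AA i j - dexp true l AB i j).
  apply: torsion_dexpB; [exact: ubounded_dsupp uAA|exact: ubounded_dsupp uAB|].
  by have [N NP] := local_iter locA; exact: torsion_iter_shy NP.
have tor2 : torsion z (fun i j => dexp true l AB i j - dexp true l BB' i j).
  apply: torsion_dexpB => //; first exact: ubounded_dsupp uAB.
  have [N NP] := local_iter locB'.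
  by apply: torsion_iter_shx => i1 j1; apply: NP.
have tor3 : torsion z (fun i j => dexp false l AA' i j - dexp false l BA i j).
  apply: torsion_dexpB => //; first exact: ubounded_dsupp uBA.
  have [N NP] := local_iter locA'.
  by apply: torsion_iter_shx => i1 j1; apply: NP.
have tor4 : torsion z (fun i j => dexp false l BA i j - dexp false l BB i j).
  apply: torsion_dexpB; [exact: ubounded_dsupp uBA|exact: ubounded_dsupp uBB|].
  by have [N NP] := local_iter locB; exact: torsion_iter_shy NP.
have tor5 : torsion z (fun i j => diter a l i j - diter c l i j).
  have -> : (fun i j => diter a l i j - diter c l i j) =
      diter (fun l j => a l j - c l j) l.
    apply/funext => i1; apply/funext => j1; rewrite /diter bexpB //.
      exact: iterable_dsupp iter_a.
    exact: iterable_dsupp iter_c.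
  apply: torsion_diter => [|l'].
    by exists (Num.max L L') => l' Ll j1; rewrite aL ?cL' ?subrr //; lia.
  by apply: iter_local.
apply/eqP; rewrite -subr_eq0; apply/eqP.
apply: (torsion_eq0 (z := z)
  (g := fun i j => dexp true l AA i j - dexp false l AA' i j - diter a l i j)).
  have := torsionB (torsionB (torsionD tor1 tor2) (torsionD tor3 tor4)) tor5.
  congr torsion; apply/funext => i1; apply/funext => j1.
  by rewrite -jacobi_c; ring.
have [[t dA] dAb] := ubounded_dexp l uAA.
have [[t' dA'] dAb'] := ubounded_dexp l uAA'.
have sgn i1 j1 : dexp false l AA' i1 j1 = (-1) ^ l * dexp true l (swap AA') j1 i1.
  by [].
have [s sP] := diter_far l iter_a.
split=> [i1|j1].
  apply: boundedB; last first.
    by exists (s - i1) => j1; rewrite /far => ?; apply: sP; rewrite /far; lia.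
  apply: boundedB => //; exists t' => j1 /dA' d0.
  by rewrite sgn d0 mulr0.
apply: boundedB; last first.
  by exists (s - j1) => i1; rewrite /far => ?; apply: sP; rewrite /far; lia.
apply: boundedB; first by exists t => i1 /dA.
by apply: (boundedZ (f := dexp true l (swap AA') j1)).
Qed.

(** [split_iterated] makes both products sums of double residues, and [swapE] brings the second to
    the order of the first. There AB and BA cancel; what remains is [jacobi_a] at infinity minus
    [jacobi_c] at 0. *)
Lemma local_jacobi l m n j :
  bexp (-1) l (fun m n =>
    zexp z true m (fun i => zexp z true n (AA i) j - zexp z false n (AB i) j) 0 -
    zexp z false m (fun i => zexp z true n (BA i) j - zexp z false n (BB i) j) 0) m n
  - (-1) ^ l * bexp (-1) l (fun n m =>
    zexp z true n (fun j => zexp z true m (swap AA' j) 0 - zexp z false m (swap BA j) 0) j -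
    zexp z false n (fun j => zexp z true m (swap AB j) 0 - zexp z false m (swap BB' j) 0) j) n m
  = bexp 1 m (fun p q => zexp z true p (a q) j - zexp z false p (c q) j) n l.
Proof.
have dsupp_loc b b' gt gf i1 j1 : local b gt gf -> dsupp (fun m n =>
    zexp z b' m (fun i => zexp z true n (gt i) j1 - zexp z false n (gf i) j1) i1).
  move=> [_ _ [M MP]] p q; exists (absz (M - q)) => k Mk.
  by apply: zexp_eq0 => i'; rewrite MP ?subrr //; lia.
have split_loc b gt gf m1 n1 i1 j1 : local b gt gf ->
    bexp (-1) l (fun m n =>
      zexp z b m (fun i => zexp z true n (gt i) j1 - zexp z false n (gf i) j1) i1) m1 n1 =
    zexp2 z b true m1 n1 (dexp b l gt) i1 j1 - zexp2 z b false m1 n1 (dexp b l gf) i1 j1.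
  by move=> [bt bf [M MP]]; apply: (split_iterated (M := M)) => // n2 i2 j2; apply: MP.
have dsupp_iter b d : iterable b d ->
    dsupp (fun p q => zexp z b p (d q) j).
  move=> [_ [L dL]] p q; exists (absz (L - q)) => k Lk.
  by apply: zexp_eq0 => i'; apply: dL; lia.
have swapE b b1 b2 g : ubounded b1 b2 (swap g) -> b1 = b ->
    (-1) ^ l * zexp2 z b1 b2 n m (dexp b l (swap g)) j 0 =
    zexp2 z b2 b1 m n (dexp (~~ b) l g) 0 j.
  move=> ug b1b; rewrite b1b in ug *.
  have js := ubounded_jsupp (ubounded_dexp l ug).
  have <- : (fun i j => (-1) ^ l * dexp b l (swap g) j i) = dexp (~~ b) l g.
    by apply/funext => i1; apply/funext => j1; rewrite dexpC.
  rewrite -zexp2Z //; apply: zexp2C => i1 j1.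
  by have [N NP] := js i1 j1; exists N => k1 k2 /NP ->; rewrite mulr0.
rewrite (bexpB _ _ _ _ (dsupp_loc _ true _ _ 0 j locA)
                       (dsupp_loc _ false _ _ 0 j locB)).
rewrite (bexpB _ _ _ _ (dsupp_loc _ true _ _ j 0 locA')
                       (dsupp_loc _ false _ _ j 0 locB')).
rewrite (bexpB _ _ _ _ (dsupp_iter _ _ iter_a) (dsupp_iter _ _ iter_c)).
have [uAA uAB _] := locA; have [uBA uBB _] := locB.
have [uAA' uBA' _] := locA'; have [uAB' uBB' _] := locB'.
rewrite !split_loc // !mulrBr !swapE //= -!zexp2_diter //.
have -> : diter a l = fun i j => dexp true l AA i j - dexp false l AA' i j.
  by apply/funext => i; apply/funext => i1; rewrite jacobi_a.
have -> : diter c l = fun i j => dexp true l BB' i j - dexp false l BB i j.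
  by apply/funext => i; apply/funext => i1; rewrite jacobi_c.
have jAA := ubounded_jsupp (ubounded_dexp l uAA).
have jBB := ubounded_jsupp (ubounded_dexp l uBB).
have jswap b b2 g : ubounded b b2 (swap g) -> jsupp b2 b (dexp (~~ b) l g).
  move=> /(ubounded_dexp l)/ubounded_jsupp js i1 j1; have [N NP] := js j1 i1.
  by exists N => k1 k2; rewrite addnC => /NP d0; rewrite -dexpC d0 mulr0.
have [jAA' jBB'] := (jswap _ _ _ uAA', jswap _ _ _ uBB').
by rewrite !zexp2B //; ring.
Qed.

End Jacobi.
End Assembly.

(** * Vertex operator algebras *)

Section ModuleFacts.
Variables (K : numFieldType) (V : lmodType K) (Y : V -> V -> int -> V).
Variables (vac om : V) (c : K).

Section Module.
Variables (W : lmodType K) (YW : V -> W -> int -> W).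
Hypothesis modW : module_axioms Y vac om c YW.

Lemma mode_zerol (w : W) (n : int) : YW 0 w n = 0.
Proof.
have := ma_linl modW 1 0 0 w n.
by rewrite !scale1r addr0 => /eqP; rewrite -subr_eq0 opprD addNKr oppr_eq0 => /eqP.
Qed.

Lemma mode_zeror (v : V) (n : int) : YW v 0 n = 0.
Proof.
have := ma_linr modW 1 v 0 0 n.
by rewrite !scale1r addr0 => /eqP; rewrite -subr_eq0 opprD addNKr oppr_eq0 => /eqP.
Qed.

Lemma modeZ (a : K) (v : V) (w : W) (n : int) : YW v (a *: w) n = a *: YW v w n.
Proof. by rewrite -[a *: w]addr0 (ma_linr modW) mode_zeror addr0. Qed.

(** [L(0), L(1)] = -L(1) without central term, so L(1) lowers weights by 1. *)
Lemma L0_L1 (a : K) (w : W) : Lop YW om 0 w = a *: w ->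
  Lop YW om 0 (Lop YW om 1 w) = (a - 1) *: Lop YW om 1 w.
Proof.
move=> w_wt; have := ma_vir modW 0 1 w.
have -> : Lop YW om 1 (Lop YW om 0 w) = a *: Lop YW om 1 w by rewrite w_wt; apply: modeZ.
rewrite /= addr0 scaleN1r => /eqP.
by rewrite subr_eq => /eqP ->; rewrite scalerBl scale1r addrC.
Qed.

End Module.

Variable proj : int -> V -> V.
Hypothesis voaV : is_voa Y vac om c proj.

(** L(1)^j v has weight h - j, and the weights of V are bounded below. *)
Lemma iter_L1_eq0 (h : int) (v : V) : Lop Y om 0 v = h%:~R *: v ->
  exists J : nat, forall j, (J <= j)%N -> iter j (Lop Y om 1) v = 0.
Proof.
move=> v_wt; have [N NP] := voa_lowb voaV.
exists (absz (h - N)).+1 => j Jj; apply: (NP (h - j%:Z)); first by lia.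
elim: j {Jj} => [|j IH]; first by rewrite subr0.
rewrite /= (L0_L1 (voa_mod voaV) IH); congr (_ *: _).
by rewrite -[1 in LHS]/(1%:~R) -intrB; congr (_%:~R); lia.
Qed.

Variables (W : lmodType K) (YW : V -> W -> int -> W).
Hypothesis modW : module_axioms Y vac om c YW.

Lemma Ystar_eq0 (v : V) (w : W) (e : int) :
    (forall h j, YW (iter j (Lop Y om 1) (proj h v)) w (e - 1 - j%:Z + 2 * h) = 0) ->
  Ystar Y om proj YW v w e = 0.
Proof.
move=> Y0; apply: fsbig1 => h _; apply: nsum0 => j.
by rewrite Y0 scaler0.
Qed.

Lemma Ystar_zeror (v : V) (e : int) : Ystar Y om proj YW v 0 e = 0.
Proof. by apply: Ystar_eq0 => h j; apply: mode_zeror. Qed.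

Lemma iter_L1_0 (j : nat) : iter j (Lop Y om 1) 0 = 0.
Proof. by elim: j => //= j ->; apply: mode_zeror (voa_mod voaV) _ _. Qed.

Lemma Ystar_zerol (w : W) (e : int) : Ystar Y om proj YW 0 w e = 0.
Proof.
apply: Ystar_eq0 => h j.
have -> : proj h 0 = 0.
  have /eqP := voa_proj_lin voaV h 1 0 0.
  by rewrite !scale1r addr0 -subr_eq0 opprD addNKr oppr_eq0 => /eqP.
by rewrite iter_L1_0 mode_zerol.
Qed.

(** Finitely many weights h occur in v, and each component is killed by a power of L(1), so finitely
    many truncated series contribute. *)
Lemma Ystar_trunc (v : V) (w : W) :
  exists E : int, forall e, E < e -> Ystar Y om proj YW v w e = 0.
Proof.
have [s [_ s0]] := voa_proj_sum voaV v.
suff [E EP] : exists E : int, forall h, h \in s -> forall (j : nat) e, E < e ->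
    YW (iter j (Lop Y om 1) (proj h v)) w (e - 1 - j%:Z + 2 * h) = 0.
  exists E => e Ee; apply: Ystar_eq0 => h j.
  have [hs|/s0 ->] := boolP (h \in s); first exact: EP.
  by rewrite iter_L1_0 mode_zerol.
elim: s {s0} => [|h s [E EP]]; first by exists 0.
have [J JP] := iter_L1_eq0 (voa_proj_wt voaV h v).
have [F FP] : exists F : int, forall j : nat, (j < J)%N -> forall e, F < e ->
    YW (iter j (Lop Y om 1) (proj h v)) w (e - 1 - j%:Z + 2 * h) = 0.
  elim: J {JP} => [|J [F FP]]; first by exists 0.
  have [N NP] := ma_trunc modW (iter J (Lop Y om 1) (proj h v)) w.
  exists (Num.max F (N + 1 + J%:Z - 2 * h)) => j; rewrite ltnS leq_eqVlt.
  by case/orP => [/eqP -> e Fe|jJ e Fe]; [apply: NP|apply: FP] => //; lia.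
exists (Num.max E F) => h'; rewrite inE => /orP[/eqP ->|h's] j e Ee; last first.
  by apply: EP => //; lia.
have [Jj|jJ] := leqP J j; first by rewrite JP ?mode_zerol.
by apply: FP => //; lia.
Qed.

End ModuleFacts.

(** * Delta functions as expansions at infinity and at zero *)

Section DeltaFunctions.
Variables (K : numFieldType) (z : K).

Lemma dz1E (F : int -> K) (e0 e1 : int) :
  dz1 z F e0 e1 = zexp z true (- e0 - 1) (fun j => F (- j - 1)) (- e1 - 1).
Proof.
apply: eq_nsum => k; rewrite /zcoef /step; congr (_ * F _); lia.
Qed.

Lemma dz2E (G : int -> K) (e0 e1 : int) :
  dz2 z G e0 e1 = zexp z false (- e0 - 1) (fun j => G (- j - 1)) (- e1 - 1).
Proof.
rewrite /dz2 /nsum mulr_fsumr; apply: eq_nsum => k.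
rewrite /zcoef /step; set n := - e0 - 1; move: (gbinom n k) => B.
rewrite !mulrA; congr (_ * G _); last by lia.
have m1 : -1 != 0 :> K by rewrite oppr_eq0 oner_neq0.
rewrite -[- z]mulN1r expfzMl expfzDr // -exprnN invr_sign.
by ring.
Qed.

End DeltaFunctions.

(** * The Jacobi identity for Y'_{Q(z)} *)

Section QJacobi.
Variables (K : numFieldType) (z : K).
Variables (V : lmodType K) (Y : V -> V -> int -> V) (vac om : V) (c : K).
Variables (proj : int -> V -> V) (W1 W2 : lmodType K).
Variables (Y1 : V -> W1 -> int -> W1) (Y2 : V -> W2 -> int -> W2).
Variable lam : W1 -> W2 -> K.
Hypothesis z0 : z != 0.
Hypothesis voaV : is_voa Y vac om c proj.
Hypothesis mod1 : module_axioms Y vac om c Y1.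
Hypothesis mod2 : module_axioms Y vac om c Y2.
Hypothesis bil : bilinear_form lam.
Hypothesis compat : compatibility z Y om proj Y1 Y2 lam.

(** Modes of Y_1^* indexed like those of a vertex operator; having finitely many positive powers of
    y becomes vanishing at small j. *)
Let A v w1 (j : int) := Ystar Y om proj Y1 v w1 (- j - 1).

Lemma YQE (mu : W1 -> W2 -> K) v e w1 w2 :
  YQ z Y om proj Y1 Y2 v mu e w1 w2 =
  zexp z true (- e - 1) (fun j => mu (A v w1 j) w2) 0 -
  zexp z false (- e - 1) (fun j => mu w1 (Y2 v w2 j)) 0.
Proof.
rewrite /YQ dz1E dz2E opprK addrN; congr (_ - _); apply: eq_zexp => j.
by rewrite /lamY2; congr (mu _ (Y2 _ _ _)); lia.
Qed.

Lemma lam0l w2 : lam 0 w2 = 0.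
Proof.
have /eqP := bil_l bil 1 0 0 w2.
by rewrite scale1r mul1r addr0 -subr_eq0 opprD addNKr oppr_eq0 => /eqP.
Qed.

Lemma lam0r w1 : lam w1 0 = 0.
Proof.
have /eqP := bil_r bil 1 w1 0 0.
by rewrite scale1r mul1r addr0 -subr_eq0 opprD addNKr oppr_eq0 => /eqP.
Qed.

Lemma lam_nsum w1 (d : nat -> K) (x : nat -> W2) :
    (exists N, forall k, (N <= k)%N -> x k = 0) ->
  lam w1 (nsum (fun k => d k *: x k)) = nsum (fun k => d k * lam w1 (x k)).
Proof.
move=> [N x0]; rewrite !(@nsum_ord _ N); first last.
- by move=> k /x0 ->; rewrite scaler0.
- by move=> k /x0 ->; rewrite lam0r mulr0.
elim: N {x0} => [|N IH]; first by rewrite !big_ord0 lam0r.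
by rewrite !big_ord_recr /= addrC (bil_r bil) IH addrC.
Qed.

Lemma bounded_A v w1 : exists t, forall j, j < t -> A v w1 j = 0.
Proof.
have [E EP] := Ystar_trunc voaV mod1 v w1.
by exists (- E - 1) => j jt; apply: EP; lia.
Qed.

Lemma bounded_Y2 v w2 : exists t, forall j, t < j -> Y2 v w2 j = 0.
Proof.
by have [N NP] := ma_trunc mod2 v w2; exists N => j Nj; apply: NP; lia.
Qed.

(** At x_0^(-n-1) the right side of the compatibility condition involves only exponents at most
    -n-1, where lower truncation gives 0 once n >= -N. The bound depends on v alone, so it survives
    replacing w1 or w2 by modes applied to them. *)
Lemma compat_local v : exists M : int, forall w1 w2 n j, M <= n ->
  zexp z true n (fun j => lam (A v w1 j) w2) j =
  zexp z false n (fun j => lam w1 (Y2 v w2 j)) j.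
Proof.
have [N NP] := compat_trunc compat v.
exists (- N) => w1 w2 n j Nn; apply/eqP; rewrite -subr_eq0; apply/eqP.
have := compat_jac compat v w1 w2 (- n - 1) (- j - 1).
rewrite dz1E dz2E /lamY2.
rewrite (_ : - (- n - 1) - 1 = n); last by lia.
rewrite (_ : - (- j - 1) - 1 = j); last by lia.
rewrite (_ : dz3 _ _ _ _ = 0); last first.
  by apply: nsum0 => k; rewrite NP ?mulr0 //; lia.
move=> <-; congr (_ - _); apply: eq_zexp => j'.
by congr (lam _ (Y2 _ _ _)); lia.
Qed.

Definition prodAA u v w1 w2 (i j : int) := lam (A v (A u w1 i) j) w2.
Definition prodAB u v w1 w2 (i j : int) := lam (A u w1 i) (Y2 v w2 j).
Definition prodBB u v w1 w2 (i j : int) := lam w1 (Y2 v (Y2 u w2 i) j).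

Lemma local_A u v w1 w2 :
  local z true (prodAA u v w1 w2) (prodAB u v w1 w2).
Proof.
have [t tP] := bounded_A u w1.
split; first split; [|move=> i|split; [|move=> i]|].
- exists t => i /tP uw j; rewrite /prodAA uw /A.
  by rewrite (Ystar_zeror _ mod1) lam0l.
- have [s sP] := bounded_A v (A u w1 i).
  by exists s => j /sP vw; rewrite /prodAA vw lam0l.
- by exists t => i /tP uw j; rewrite /prodAB uw lam0l.
- have [s sP] := bounded_Y2 v w2.
  by exists s => j /sP vw; rewrite /prodAB vw lam0r.
have [M MP] := compat_local v.
by exists M => n i j Mn; apply: MP.
Qed.

Lemma local_B u v w1 w2 :
  local z false (fun i j => prodAB v u w1 w2 j i) (prodBB u v w1 w2).
Proof.
have [t tP] := bounded_Y2 u w2.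
split; first split; [|move=> i|split; [|move=> i]|].
- by exists t => i /tP uw j; rewrite /prodAB uw lam0r.
- have [s sP] := bounded_A v w1.
  by exists s => j /sP vw; rewrite /prodAB vw lam0l.
- by exists t => i /tP uw j; rewrite /prodBB uw (mode_zeror mod2) lam0r.
- have [s sP] := bounded_Y2 v (Y2 u w2 i).
  by exists s => j /sP vw; rewrite /prodBB vw lam0r.
have [M MP] := compat_local v.
by exists M => n i j Mn; apply: MP.
Qed.

(** [lam] passes through the three sums because truncation makes them finite; the rest is the change
    from exponents to modes. *)
Lemma Y2_jacobi u v w1 w2 (l i j : int) :
  dexp true l (swap (prodBB v u w1 w2)) i j - dexp false l (prodBB u v w1 w2) i j =
  diter (fun l j => lam w1 (Y2 (Y u v l) w2 j)) l i j.
Proof.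
have lamB (x y : W2) : lam w1 (x - y) = lam w1 x - lam w1 y.
  by rewrite addrC -scaleN1r (bil_r bil) mulN1r addrC.
have lamZ (d : K) (x : W2) : lam w1 (d *: x) = d * lam w1 x.
  by rewrite -[d *: x]addr0 (bil_r bil) lam0r addr0.
have [N NP] := ma_trunc mod2 u w2; have [N' N'P] := ma_trunc mod2 v w2.
have [L LP] := ma_trunc (voa_mod voaV) u v.
have := congr1 (lam w1) (ma_jacobi mod2 u v w2 (- l - 1) (- i - 1) (- j - 1)).
rewrite lamB /jac_T1 /jac_T2 /jac_T3 lamZ.
rewrite (_ : - (- l - 1) - 1 = l); last by lia.
rewrite lam_nsum; last first.
  by exists (absz (N' - j)) => k Nk; rewrite N'P ?(mode_zeror mod2) //; lia.
rewrite lam_nsum; last first.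
  by exists (absz (N - i)) => k Nk; rewrite NP ?(mode_zeror mod2) //; lia.
rewrite lam_nsum; last first.
  by exists (absz (L - l)) => k Lk; rewrite LP ?(mode_zerol mod2) //; lia.
move=> E; apply: etrans (etrans _ E) _.
  congr (_ - _ * _); apply: eq_nsum => k; rewrite /swap /prodBB.
    by congr (_ * lam _ (Y2 _ (Y2 _ _ _) _)); lia.
  by congr (_ * lam _ (Y2 _ (Y2 _ _ _) _)); lia.
apply: eq_nsum => k; rewrite gbinom_opp expr1n mulr1.
by congr (gbinom _ _ * lam _ (Y2 (Y _ _ _) _ _)); lia.
Qed.

Lemma YQ_jacobi u v w1 w2 :
  @jacobi_identity K K^o
    (fun e1 e2 => YQ z Y om proj Y1 Y2 u (YQ z Y om proj Y1 Y2 v lam e2) e1 w1 w2)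
    (fun e1 e2 => YQ z Y om proj Y1 Y2 v (YQ z Y om proj Y1 Y2 u lam e1) e2 w1 w2)
    (fun e0 e2 => YQ z Y om proj Y1 Y2 (Y u v (- e0 - 1)) lam e2 w1 w2).
Proof.
move=> e0 e1 e2; pose l := - e0 - 1; pose m := - e1 - 1; pose n := - e2 - 1.
have [L LP] := ma_trunc (voa_mod voaV) u v.
pose a l j := lam (A (Y u v l) w1 j) w2.
pose b l j := lam w1 (Y2 (Y u v l) w2 j).
have ia : iterable true a.
  split=> [l'|]; last first.
    by exists L => l' /LP uv j; rewrite /a uv /A (Ystar_zerol voaV mod1) lam0l.
  have [t tP] := bounded_A (Y u v l') w1.
  by exists t => j /tP; rewrite /a => ->; rewrite lam0l.
have ib : iterable false b.
  split=> [l'|]; last first.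
    by exists L => l' /LP uv j; rewrite /b uv (mode_zerol mod2) lam0r.
  have [t tP] := bounded_Y2 (Y u v l') w2.
  by exists t => j /tP; rewrite /b => ->; rewrite lam0r.
have loc_ab l' : exists M, forall n j, M <= n ->
    zexp z true n (a l') j = zexp z false n (b l') j.
  by have [M MP] := compat_local (Y u v l'); exists M => n' j; apply: MP.
(* The last argument 0, like the index i = 0 built into [local_jacobi], reads off the residue in
   each variable. *)
have := local_jacobi z0 (local_A u v w1 w2) (local_B u v w1 w2)
  (local_A v u w1 w2) (local_B v u w1 w2) ia ib loc_ab (Y2_jacobi u v w1 w2) l m n 0.
move=> E; apply: etrans (etrans _ E) _.
  congr (_ - _ * _); apply: eq_nsum => k; rewrite YQE; congr (_ * (_ - _)).
  - rewrite (_ : - (e1 - _ + _) - 1 = m + l - k%:Z); last by rewrite /m /l; lia.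
    apply: eq_zexp => i; rewrite YQE.
    by rewrite (_ : - (e2 - _) - 1 = n + k%:Z) //; rewrite /n; lia.
  - rewrite (_ : - (e1 - _ + _) - 1 = m + l - k%:Z); last by rewrite /m /l; lia.
    apply: eq_zexp => i; rewrite YQE.
    by rewrite (_ : - (e2 - _) - 1 = n + k%:Z) //; rewrite /n; lia.
  - rewrite (_ : - (e2 - _ + _) - 1 = n + l - k%:Z); last by rewrite /n /l; lia.
    apply: eq_zexp => i; rewrite YQE.
    by rewrite (_ : - (e1 - _) - 1 = m + k%:Z) //; rewrite /m; lia.
  - rewrite (_ : - (e2 - _ + _) - 1 = n + l - k%:Z); last by rewrite /n /l; lia.
    apply: eq_zexp => i; rewrite YQE.
    by rewrite (_ : - (e1 - _) - 1 = m + k%:Z) //; rewrite /m; lia.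
apply: eq_nsum => k; rewrite gbinom_opp expr1n mulr1 YQE.
rewrite (_ : - (e0 - _) - 1 = l + k%:Z); last by rewrite /l; lia.
by rewrite (_ : - (e2 + e1 + _ + 1) - 1 = n + m - k%:Z) //; rewrite /n /m; lia.
Qed.

End QJacobi.

Unset Implicit Arguments.

(* The complex numbers are R[i] for R : realType (any realType is the real line). *)
Theorem theorem6p1 (R : realType)
  (V : lmodType R[i]) (Y : V -> V -> int -> V) (vac om : V) (c : R[i])
  (proj : int -> V -> V) (HV : is_voa Y vac om c proj)
  (W1 : lmodType R[i]) (Y1 : V -> W1 -> int -> W1) (HW1 : is_module Y vac om c Y1)
  (W2 : lmodType R[i]) (Y2 : V -> W2 -> int -> W2) (HW2 : is_module Y vac om c Y2)
  (z : R[i]) (hz : z != 0)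
  (lam : W1 -> W2 -> R[i]) (hlam : bilinear_form lam)
  (hcompat : compatibility z Y om proj Y1 Y2 lam) :
  forall (v1 v2 : V) (w1 : W1) (w2 : W2),
    jacobi_identity
      (fun e1 e2 => YQ z Y om proj Y1 Y2 v1 (YQ z Y om proj Y1 Y2 v2 lam e2) e1 w1 w2)
      (fun e1 e2 => YQ z Y om proj Y1 Y2 v2 (YQ z Y om proj Y1 Y2 v1 lam e1) e2 w1 w2)
      (fun e0 e2 => YQ z Y om proj Y1 Y2 (Y v1 v2 (- e0 - 1)) lam e2 w1 w2).
Proof.
move=> v1 v2 w1 w2.
exact: (YQ_jacobi hz HV (mod_ax HW1) (mod_ax HW2) hlam hcompat v1 v2 w1 w2).
Qed.
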